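(* Let $O$ be the origin of $\mathbb{R}^2$ and let $(x(t),y(t))$, $t_0\le t\le t_1$, be a simple curve of class $C^2$ in $\mathbb{R}^2$ not passing through $O$. Suppose that $P=P(t)$ is a moving point in $\mathbb{R}^2$ (with $\overrightarrow{OP}(t)\neq \vec 0$) satisfying, for $t_0\le t\le t_1$, the following conditions: 1) for $\mathcal{D}=|\overrightarrow{OP}|$, $$\frac{d\mathcal{D}}{dt}=\frac{x(t)x'(t)+y(t)y'(t)}{\sqrt{x^2(t)+y^2(t)}},\qquad \mathcal{D}|_{t=t_0}=\sqrt{x^2(t_0)+y^2(t_0)};$$ 2) $$\frac{d\vec e_{\overrightarrow{OP}}}{dt}=\frac{(x(t)y'(t)-x'(t)y(t))\,(-y(t),x(t))}{(x^2(t)+y^2(t))^{3/2}},\qquad \vec e_{\overrightarrow{OP}}|_{t=t_0}=\frac{(x(t_0),y(t_0))}{\sqrt{x^2(t_0)+y^2(t_0)}}.$$ Then the trajectory of $P$ is $\vec r(t)=(x(t),y(t))$, $t_0\le t\le t_1$; that is, $\overrightarrow{OP}(t)=(x(t),y(t))$ for all $t\in[t_0,t_1]$.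
   Context: $\vec e_{\vec w}=\vec w/|\vec w|$ denotes the unit vector in the direction of a nonzero vector $\vec w$. *)

(* Defs.v *)
From Stdlib Require Import Reals.
Open Scope R_scope.

Definition vec : Type := (R * R)%type.

Definition origin : vec := (0, 0).

Definition vscal (a : R) (w : vec) : vec := (a * fst w, a * snd w).

Definition vnorm (w : vec) : R := sqrt (fst w ^ 2 + snd w ^ 2).

(* w / |w|; only meaningful for w <> origin. *)
Definition unit_dir (w : vec) : vec := vscal (/ vnorm w) w.

Definition cc (a b t : R) : Prop := a <= t <= b.

(* Derivatives on [a, b] are relative to [a, b], hence one-sided at the
   endpoints: nothing is assumed about the values of f outside [a, b]. *)
Definition has_deriv_on (a b : R) (f f' : R -> R) : Prop :=
  forall t, cc a b t -> D_in f f' (cc a b) t.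

Definition has_vderiv_on (a b : R) (r r' : R -> vec) : Prop :=
  has_deriv_on a b (fun t => fst (r t)) (fun t => fst (r' t)) /\
  has_deriv_on a b (fun t => snd (r t)) (fun t => snd (r' t)).

Definition vcontinuous_on (a b : R) (r : R -> vec) : Prop :=
  forall t, cc a b t ->
    continue_in (fun s => fst (r s)) (cc a b) t /\
    continue_in (fun s => snd (r s)) (cc a b) t.

Definition C2_on (a b : R) (r : R -> vec) : Prop :=
  exists r' r'' : R -> vec,
    has_vderiv_on a b r r' /\ has_vderiv_on a b r' r'' /\
    vcontinuous_on a b r''.

(* No self-intersection; simple closed curves (r a = r b) are allowed. *)
Definition simple_on (a b : R) (r : R -> vec) : Prop :=
  forall s t, cc a b s -> cc a b t -> s < t -> r s = r t -> s = a /\ t = b.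

(* Main.v *)
(** Both the modulus and the direction of the position vector (x, y) solve the
    initial value problems prescribed for P: with r = |(x, y)|, one has
    r' = (x x' + y y') / r and (x / r)' = - y (x y' - x' y) / r^3,
    (y / r)' = x (x y' - x' y) / r^3.  The right-hand sides do not involve P, so
    uniqueness is the mean value theorem, and P = |P| e_P. *)
Require Import Defs.
From Stdlib Require Import Reals.
From Stdlib Require Import Lra.
Open Scope R_scope.

(** The limit behind [D_in] sees the derivative function only through its value at [t]. This lets
    pointwise rules be stated with constant derivative functions. *)
Lemma D_in_value (f d e : R -> R) (D : R -> Prop) (t : R) :
  d t = e t -> D_in f d D t -> D_in f e D t.
Proof. unfold D_in; intros E H; rewrite <- E; exact H. Qed.

(** Chain rule with a relative inner derivative and a two-sided outer one. [Dcomp] yields it on [D]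
    intersected with the preimage of [no_cond], which is [D] itself. *)
Lemma D_in_derivable_comp (f g : R -> R) (d l : R) (D : R -> Prop) (t : R) :
  D_in f (fun _ => d) D t -> derivable_pt_lim g (f t) l ->
  D_in (fun s => g (f s)) (fun _ => d * l) D t.
Proof.
intros Hf Hg.
apply (derivable_pt_lim_D_in g (fun _ => l)) in Hg.
intros eps Heps.
destruct (Dcomp D no_cond (fun _ => d) (fun _ => l) f g t Hf Hg eps Heps)
  as [al [Hal H]].
exists al; split; [exact Hal|].
intros s [[Hs Hne] Hd]; apply H.
repeat split; assumption.
Qed.

(** For [a <= b], the nearest-point retraction of the line onto [[a, b]]. Precomposing with it makes
    a function known only on [[a, b]] fit theorems that ask for two-sided continuity and
    derivatives. *)
Definition clamp (a b t : R) : R := Rmax a (Rmin b t).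

Lemma clamp_bounds (a b t : R) : a <= b -> a <= clamp a b t <= b.
Proof.
intros; unfold clamp, Rmax, Rmin.
destruct (Rle_dec b t); destruct (Rle_dec a _); lra.
Qed.

Lemma clamp_id (a b t : R) : a <= t <= b -> clamp a b t = t.
Proof.
intros; unfold clamp, Rmax, Rmin.
destruct (Rle_dec b t); destruct (Rle_dec a _); lra.
Qed.

(** The retraction is 1-Lipschitz and fixes [t], so a radius that works for [h] at [t] also works
    for [h] after clamping. *)
Lemma clamp_contract (a b s t : R) :
  a <= b -> a <= t <= b -> Rabs (clamp a b s - t) <= Rabs (s - t).
Proof.
intros; unfold clamp, Rmax, Rmin, Rabs.
destruct (Rle_dec b s); destruct (Rle_dec a _);
  repeat destruct (Rcase_abs _); lra.
Qed.

Lemma continue_in_clamp (a b : R) (h : R -> R) (t : R) :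
  a <= b -> cc a b t -> continue_in h (cc a b) t ->
  continuity_pt (fun s => h (clamp a b s)) t.
Proof.
intros Hab Ht Hc eps Heps.
destruct (Hc eps Heps) as [al [Hal H]].
exists al; split; [exact Hal|].
intros s [_ Hd]; simpl in *; unfold Rdist in *.
rewrite (clamp_id a b t) by exact Ht.
(* [continue_in] is a limit over points distinct from [t], so it is silent when [s] is clamped onto
   [t] itself, as happens beyond an endpoint. *)
destruct (Req_dec (clamp a b s) t) as [E|E].
- rewrite E, Rminus_diag, Rabs_R0; exact Heps.
- apply H; split.
  + split; [apply clamp_bounds; exact Hab | auto].
  + eapply Rle_lt_trans; [apply clamp_contract; assumption | exact Hd].
Qed.

(** Restricted to interior points: at an endpoint, clamping creates a corner unless [l] is zero. *)
Lemma D_in_clamp (a b : R) (h : R -> R) (l t : R) :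
  a < t < b -> D_in h (fun _ => l) (cc a b) t ->
  derivable_pt_lim (fun s => h (clamp a b s)) t l.
Proof.
intros Ht Hd eps Heps.
destruct (Hd eps Heps) as [al [Hal H]].
(* Capping the radius by the distances to both endpoints keeps [t + k] in [[a, b]], where [clamp] is
   the identity. *)
assert (Hm : 0 < Rmin al (Rmin (t - a) (b - t))) by
  (repeat apply Rmin_pos; lra).
exists (mkposreal _ Hm); intros k Hk Hkd; simpl in Hkd.
apply Rmin_Rgt_l in Hkd; destruct Hkd as [H1 H2].
apply Rmin_Rgt_l in H2; destruct H2 as [H2 H3].
assert (Hin : a <= t + k <= b).
{ apply Rgt_lt, Rabs_def2 in H2; apply Rgt_lt, Rabs_def2 in H3; lra. }
rewrite (clamp_id a b (t + k)), (clamp_id a b t) by lra.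
specialize (H (t + k)); simpl in H; unfold Rdist in H.
replace (t + k - t) with k in H by ring.
apply H; split; [split; [exact Hin | lra] | exact H1].
Qed.

(** The difference [h] has zero relative derivative. After clamping it is continuous on all of
    [[a, b]] and has zero two-sided derivative inside, so the mean value theorem makes it
    constant. *)
Lemma has_deriv_on_unique (a b : R) (f g d : R -> R) :
  a < b -> has_deriv_on a b f d -> has_deriv_on a b g d -> f a = g a ->
  forall t, cc a b t -> f t = g t.
Proof.
intros Hab Hf Hg E t Ht.
set (h := fun s => f s - g s).
assert (Hh : forall s, cc a b s -> D_in h (fun _ => 0) (cc a b) s).
{ intros s Hs.
  apply (D_in_value _ (fun u => d u - d u)); [ring|].
  apply Dminus; [apply Hf | apply Hg]; exact Hs. }
assert (pr : forall s, a < s < b -> derivable_pt (fun u => h (clamp a b u)) s).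
{ intros s Hs; exists 0; apply D_in_clamp; [exact Hs|].
  apply Hh; unfold cc; lra. }
assert (K : constant_D_eq (fun u => h (clamp a b u)) (fun s => a <= s <= b)
              (h (clamp a b a))).
{ apply (null_derivative_loc _ a b pr).
  - intros s Hs; apply continue_in_clamp; [lra | exact Hs |].
    apply (cont_deriv h (fun _ => 0)), Hh, Hs.
  - intros s Hs; apply derive_pt_eq_0, D_in_clamp; [exact Hs|].
    apply Hh; unfold cc; lra. }
specialize (K t Ht); simpl in K.
rewrite !clamp_id in K by (unfold cc in Ht; lra).
unfold h in K; lra.
Qed.

Lemma sumsq_pos (u v : R) : (u, v) <> origin -> 0 < u ^ 2 + v ^ 2.
Proof.
intros H.
destruct (Req_dec u 0) as [Eu|Eu].
- destruct (Req_dec v 0) as [Ev|Ev].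
  + exfalso; apply H; subst; reflexivity.
  + assert (0 < v ^ 2) by (rewrite <- Rsqr_pow2; apply Rlt_0_sqr, Ev).
    pose proof (pow2_ge_0 u); lra.
- assert (0 < u ^ 2) by (rewrite <- Rsqr_pow2; apply Rlt_0_sqr, Eu).
  pose proof (pow2_ge_0 v); lra.
Qed.

(** Turns the real exponent into an integer power of the norm, which [field] can handle. *)
Lemma Rpower_3_2 (s : R) : 0 < s -> Rpower s (3 / 2) = sqrt s ^ 3.
Proof.
intros Hs.
rewrite <- (Rpower_sqrt s Hs), <- Rpower_pow by apply exp_pos.
rewrite Rpower_mult; f_equal; simpl; lra.
Qed.

Lemma vnorm_unit_dir (w : vec) :
  w <> origin -> vscal (vnorm w) (unit_dir w) = w.
Proof.
destruct w as [u v]; intros H.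
assert (0 < vnorm (u, v)) by (apply sqrt_lt_R0, sumsq_pos, H).
unfold unit_dir, vscal; simpl; f_equal; field; lra.
Qed.

Lemma derivable_pt_lim_Rinv (u : R) :
  u <> 0 -> derivable_pt_lim Rinv u (- / u ^ 2).
Proof.
intros Hu.
apply (derivable_pt_lim_ext (fct_cte 1 / id)%F).
- intros z; unfold div_fct, fct_cte, id; apply Rdiv_1_l.
- replace (- / u ^ 2) with ((0 * id u - 1 * fct_cte 1 u) / Rsqr (id u))
    by (unfold fct_cte, id, Rsqr; field; exact Hu).
  apply derivable_pt_lim_div;
    [apply derivable_pt_lim_const | apply derivable_pt_lim_id | exact Hu].
Qed.

Lemma D_in_norm (D : R -> Prop) (x y : R -> R) (p q t : R) :
  D_in x (fun _ => p) D t -> D_in y (fun _ => q) D t ->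
  0 < x t ^ 2 + y t ^ 2 ->
  D_in (fun s => sqrt (x s ^ 2 + y s ^ 2))
    (fun _ => (x t * p + y t * q) / sqrt (x t ^ 2 + y t ^ 2)) D t.
Proof.
intros Hx Hy Hpos.
set (r := sqrt (x t ^ 2 + y t ^ 2)).
assert (Hr : 0 < r) by (apply sqrt_lt_R0, Hpos).
assert (Hs : D_in (fun s => x s ^ 2 + y s ^ 2)
               (fun _ => 2 * (x t * p + y t * q)) D t).
{ apply (D_in_value _ (fun s => p * (2 * x t) + q * (2 * y t))); [ring|].
  apply (Dadd D (fun _ => p * (2 * x t)) (fun _ => q * (2 * y t))
           (fun s => x s ^ 2) (fun s => y s ^ 2)).
  - apply (D_in_derivable_comp x (fun u => u ^ 2)); [exact Hx|].
    replace (2 * x t) with (INR 2 * x t ^ Nat.pred 2) by (simpl; ring).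
    apply derivable_pt_lim_pow.
  - apply (D_in_derivable_comp y (fun u => u ^ 2)); [exact Hy|].
    replace (2 * y t) with (INR 2 * y t ^ Nat.pred 2) by (simpl; ring).
    apply derivable_pt_lim_pow. }
apply (D_in_value _ (fun _ => 2 * (x t * p + y t * q) * / (2 * r))).
- field; lra.
- apply (D_in_derivable_comp _ sqrt _ _ _ _ Hs).
  apply derivable_pt_lim_sqrt, Hpos.
Qed.

(** Quotient rule for [f] over the norm, with numerator and denominator multiplied by the norm.
    Keeping [f] generic serves both coordinates of the direction, [f = x] and [f = y]. *)
Lemma D_in_div_norm (D : R -> Prop) (x y f : R -> R) (p q m t : R) :
  D_in x (fun _ => p) D t -> D_in y (fun _ => q) D t ->
  0 < x t ^ 2 + y t ^ 2 -> D_in f (fun _ => m) D t ->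
  D_in (fun s => / sqrt (x s ^ 2 + y s ^ 2) * f s)
    (fun _ => (m * (x t ^ 2 + y t ^ 2) - f t * (x t * p + y t * q))
              / sqrt (x t ^ 2 + y t ^ 2) ^ 3) D t.
Proof.
intros Hx Hy Hpos Hf.
set (r := sqrt (x t ^ 2 + y t ^ 2)).
assert (Hr : 0 < r) by (apply sqrt_lt_R0, Hpos).
(* [field] treats [r] as an atom, so its link with the sum of squares must be supplied. *)
assert (Hr2 : x t ^ 2 + y t ^ 2 = r ^ 2) by
  (symmetry; apply pow2_sqrt; lra).
assert (Hi : D_in (fun s => / sqrt (x s ^ 2 + y s ^ 2))
               (fun _ => (x t * p + y t * q) / r * (- / r ^ 2)) D t).
{ apply (D_in_derivable_comp _ Rinv _ _ _ _ (D_in_norm D x y p q t Hx Hy Hpos)).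
  apply derivable_pt_lim_Rinv; fold r; lra. }
apply (D_in_value _ (fun s => (x t * p + y t * q) / r * (- / r ^ 2) * f s
                               + / sqrt (x s ^ 2 + y s ^ 2) * m)).
- fold r; rewrite Hr2; field; lra.
- exact (Dmult D (fun _ => _) (fun _ => m) _ f t Hi Hf).
Qed.

Theorem theorem2p2 (t0 t1 : R) (x y x' y' : R -> R) (P : R -> vec)
  (ht : t0 < t1)
  (hsimple : simple_on t0 t1 (fun t => (x t, y t)))
  (hC2 : C2_on t0 t1 (fun t => (x t, y t)))
  (hderiv : has_vderiv_on t0 t1 (fun t => (x t, y t)) (fun t => (x' t, y' t)))
  (hO : forall t, t0 <= t <= t1 -> (x t, y t) <> origin)
  (hP : forall t, t0 <= t <= t1 -> P t <> origin)
  (hD : has_deriv_on t0 t1 (fun t => vnorm (P t))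
          (fun t => (x t * x' t + y t * y' t) / sqrt (x t ^ 2 + y t ^ 2)))
  (hD0 : vnorm (P t0) = sqrt (x t0 ^ 2 + y t0 ^ 2))
  (he : has_vderiv_on t0 t1 (fun t => unit_dir (P t))
          (fun t => vscal ((x t * y' t - x' t * y t)
                             / Rpower (x t ^ 2 + y t ^ 2) (3 / 2))
                          (- y t, x t)))
  (he0 : unit_dir (P t0) = vscal (/ sqrt (x t0 ^ 2 + y t0 ^ 2)) (x t0, y t0)) :
  forall t, t0 <= t <= t1 -> P t = (x t, y t).
Proof.
destruct hderiv as [Hx Hy]; simpl in Hx, Hy.
destruct he as [He1 He2].
assert (Hpos : forall t, cc t0 t1 t -> 0 < x t ^ 2 + y t ^ 2)
  by (intros t Ht; apply sumsq_pos, hO, Ht).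
assert (Hnorm : forall t, cc t0 t1 t -> vnorm (P t) = vnorm (x t, y t)).
{ apply (has_deriv_on_unique t0 t1 _ _ _ ht hD); [|exact hD0].
  intros t Ht.
  exact (D_in_norm _ x y _ _ t (Hx t Ht) (Hy t Ht) (Hpos t Ht)). }
assert (Hfst : forall t, cc t0 t1 t ->
                 fst (unit_dir (P t)) = fst (unit_dir (x t, y t))).
{ apply (has_deriv_on_unique t0 t1 _ _ _ ht He1);
    [|rewrite he0; reflexivity].
  intros t Ht; specialize (Hpos t Ht).
  eapply D_in_value;
    [|exact (D_in_div_norm _ x y x _ _ _ t (Hx t Ht) (Hy t Ht) Hpos (Hx t Ht))].
  (* The numerators agree because [x' (x^2 + y^2) - x (x x' + y y') = - y (x y' - x' y)]. *)
  simpl; rewrite Rpower_3_2 by exact Hpos.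
  field; apply Rgt_not_eq, sqrt_lt_R0, Hpos. }
assert (Hsnd : forall t, cc t0 t1 t ->
                 snd (unit_dir (P t)) = snd (unit_dir (x t, y t))).
{ apply (has_deriv_on_unique t0 t1 _ _ _ ht He2);
    [|rewrite he0; reflexivity].
  intros t Ht; specialize (Hpos t Ht).
  eapply D_in_value;
    [|exact (D_in_div_norm _ x y y _ _ _ t (Hx t Ht) (Hy t Ht) Hpos (Hy t Ht))].
  (* Here the identity is [y' (x^2 + y^2) - y (x x' + y y') = x (x y' - x' y)]. *)
  simpl; rewrite Rpower_3_2 by exact Hpos.
  field; apply Rgt_not_eq, sqrt_lt_R0, Hpos. }
intros t Ht.
rewrite <- (vnorm_unit_dir (P t)) by exact (hP t Ht).
rewrite <- (vnorm_unit_dir (x t, y t)) by exact (hO t Ht).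
rewrite (Hnorm t Ht); f_equal.
apply injective_projections; auto.
Qed.
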